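(* For every real $u>0$ and every $t\in\mathbb{R}$, \[ \sum_{k\in\mathbb{Z}}\varphi(t+uk)=\sum_{k\in\mathbb{Z}}\frac{1}{u}\,\widehat\varphi\Bigl(\frac{k}{u}\Bigr)e^{2\pi i k t/u}. \]
   Context: $\varphi\colon\mathbb{R}\to\mathbb{R}$ denotes the unique infinitely differentiable function with compact support such that $\operatorname{supp}(\varphi)=[-1,1]$, $\varphi(t)>0$ for all $t\in(-1,1)$, $\varphi(0)=1$, and $\varphi'(t)=2\bigl(\varphi(2t+1)-\varphi(2t-1)\bigr)$ for all $t\in\mathbb{R}$. Its Fourier transform is $\widehat\varphi(z)=\int_{\mathbb{R}}\varphi(t)e^{-2\pi i t z}\,dt$. *)

(* Defs.v *)
From Stdlib Require Import Reals ZArith List.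
From Coquelicot Require Import Coquelicot.
Open Scope R_scope.

Definition Cexp (z : C) : C :=
  (exp (Re z) * cos (Im z), exp (Re z) * sin (Im z)).

(* Topological support: closure of the set of points where f does not vanish. *)
Definition support (f : R -> R) : R -> Prop :=
  adherence (fun t => f t <> 0).

(* The infinitely differentiable, compactly supported solution of
   f'(t) = 2 (f(2t+1) - f(2t-1)) with f(0) = 1, which is unique. *)
Record is_up_function (f : R -> R) : Prop := {
  up_smooth : forall (n : nat) (t : R), ex_derive_n f n t;
  up_compact_support : Rtopology.compact (support f);
  up_support : forall t : R, support f t <-> -1 <= t <= 1;
  up_pos : forall t : R, -1 < t < 1 -> 0 < f t;
  up_0 : f 0 = 1;
  up_derive : forall t : R,
    is_derive f t (2 * (f (2 * t + 1) - f (2 * t - 1)))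
}.

(* The argument z is complex.  The integral is an improper Riemann integral in
   C as a real normed module; when f is continuous with compact support it
   exists and agrees with the Lebesgue integral. *)
Definition Fourier (f : R -> R) (z : C) : C :=
  RInt_gen (V := C_R_CompleteNormedModule)
    (fun t : R => (RtoC (f t) * Cexp (- (2 * PI * Ci * RtoC t * z)))%C)
    (Rbar_locally m_infty) (Rbar_locally p_infty).

(* The directed set of finite subsets of Z, represented by duplicate-free
   lists: a property holds eventually if it holds for all finite sets that
   contain some fixed finite set. *)
Definition finite_sets_Z (P : list Z -> Prop) : Prop :=
  exists F0 : list Z, forall F : list Z, NoDup F -> incl F0 F -> P F.

Definition sum_list {V : NormedModule R_AbsRing} (a : Z -> V) (F : list Z) : V :=
  fold_right plus zero (map a F).

(* Unordered summation over Z, with no symmetric or one-sided grouping. *)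
Definition is_sum_Z {V : NormedModule R_AbsRing} (a : Z -> V) (s : V) : Prop :=
  filterlim (sum_list a) finite_sets_Z (locally s).

(* Main.v *)
Require Import Defs.
From Stdlib Require Import Reals ZArith List Permutation Lra Lia.
From Coquelicot Require Import Coquelicot.
Open Scope R_scope.

(** This is an instance of the Poisson summation formula for functions [f] of
    class C^2 with compact support ([poisson_summation]).

    Write [w k = 2 PI k / u].  The [k]-th term of the right-hand series has real
    and imaginary parts [1/u] times the integrals of
    [f x * cos (w k * (x - t))] and [- f x * sin (w k * (x - t))].  Two
    integrations by parts show that both are O(1/k^2) ([cosint_decay]), so the
    two series converge absolutely and unordered summation agrees with
    the limit of the symmetric partial sums ([is_sum_Z_of_bounded]).  It remains
    to identify that limit.

    The imaginary parts are odd in [k], so their symmetric sums vanish.  For the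
    real parts, the [n]-th symmetric sum is [1/u] times the integral of [f]
    against the Dirichlet kernel [D_n] centred at [t].  The kernel has period
    [u], so cutting the line at the points [t + (j + 1/2) u]
    turns this integral into a finite sum of integrals over [-u/2, u/2], one for
    each translate [y |-> f (y + t + u j)].  Since the symmetric sums are already
    known to converge, their limit is also the limit of their Cesaro means
    ([Cesaro_1]); averaging replaces [D_n] by the nonnegative Fejer kernel, for
    which the integral of the [j]-th translate tends to its value
    [f (t + u j)] at the centre ([fejer_convergence]).  The sum of these finitely
    many values is the left-hand side.

    The Fejer step needs no decomposition of the interval: with [Q_N] the sum of
    [D_0], ..., [D_N], the product [(2 - 2 cos x) Q_N x] telescopes to
    [2 - 2 cos ((N+1) x)], hence stays below 4, and a Lipschitz function satisfies
    [|f y - f 0| <= eps + M (2 - 2 cos x)] on a whole period.  Integrating against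
    [Q_N] bounds the error of the mean by [eps + 4 M / (N+1)]. *)

(** * Unordered sums over the integers *)

Fixpoint Zinterval (n : nat) : list Z :=
  match n with
  | O => 0%Z :: nil
  | S m => Z.of_nat n :: (- Z.of_nat n)%Z :: Zinterval m
  end.

Lemma in_Zinterval : forall n k, In k (Zinterval n) <-> (Z.abs k <= Z.of_nat n)%Z.
Proof.
  induction n as [|n IH]; intros k; cbn [Zinterval In].
  - lia.
  - rewrite IH. lia.
Qed.

Lemma NoDup_Zinterval : forall n, NoDup (Zinterval n).
Proof.
  induction n as [|n IH]; cbn [Zinterval].
  - repeat constructor. simpl. tauto.
  - constructor; [|constructor; trivial]; cbn [In]; rewrite in_Zinterval; lia.
Qed.

Lemma incl_Zinterval : forall F : list Z, exists n, incl F (Zinterval n).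
Proof.
  induction F as [|k F [n IH]].
  - exists O. intros k [].
  - exists (n + Z.to_nat (Z.abs k))%nat. intros m [->|Hm]; apply in_Zinterval; [lia|].
    apply IH, in_Zinterval in Hm. lia.
Qed.

(** [sum_list] lands in the carrier of a normed module, where the arithmetic
    tactics do not recognise the real numbers; the result type here is [R]. *)
Definition rsum (a : Z -> R) (F : list Z) : R := sum_list (V := R_NormedModule) a F.

Lemma rsum_cons : forall (a : Z -> R) k F, rsum a (k :: F) = a k + rsum a F.
Proof. reflexivity. Qed.

Lemma rsum_Zinterval_S : forall (a : Z -> R) n,
  rsum a (Zinterval (S n)) = a (Z.of_nat (S n)) + a (- Z.of_nat (S n))%Z + rsum a (Zinterval n).
Proof. intros. cbn [Zinterval]. rewrite !rsum_cons. ring. Qed.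

Lemma rsum_app : forall (a : Z -> R) F G, rsum a (F ++ G) = rsum a F + rsum a G.
Proof.
  intros a F G. induction F as [|k F IH]; cbn [app].
  - change (rsum a nil) with 0. ring.
  - rewrite !rsum_cons, IH. ring.
Qed.

Lemma rsum_perm : forall (a : Z -> R) F G, Permutation F G -> rsum a F = rsum a G.
Proof.
  intros a F G H. induction H; rewrite ?rsum_cons; lra.
Qed.

Lemma rsum_plus : forall (a b : Z -> R) F,
  rsum (fun k => a k + b k) F = rsum a F + rsum b F.
Proof.
  intros a b F. induction F as [|k F IH].
  - change (0 = 0 + 0). ring.
  - rewrite !rsum_cons, IH. ring.
Qed.

Lemma rsum_mult_l : forall c (a : Z -> R) F, rsum (fun k => c * a k) F = c * rsum a F.
Proof.
  intros c a F. induction F as [|k F IH].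
  - change (0 = c * 0). ring.
  - rewrite !rsum_cons, IH. ring.
Qed.

Lemma rsum_ext : forall (a b : Z -> R) F,
  (forall k, a k = b k) -> rsum a F = rsum b F.
Proof.
  intros a b F H. induction F as [|k F IH]; [reflexivity|].
  rewrite !rsum_cons, IH, H. reflexivity.
Qed.

Lemma rsum_zero : forall (a : Z -> R) F,
  (forall k, In k F -> a k = 0) -> rsum a F = 0.
Proof.
  intros a F H. induction F as [|k F IH]; [reflexivity|].
  rewrite rsum_cons, IH, H; try ring; simpl; auto.
  intros; apply H; simpl; auto.
Qed.

Lemma Rabs_rsum_le : forall (a : Z -> R) F,
  Rabs (rsum a F) <= rsum (fun k => Rabs (a k)) F.
Proof.
  intros a F. induction F as [|k F IH].
  - change (Rabs 0 <= 0). rewrite Rabs_R0. lra.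
  - rewrite !rsum_cons. eapply Rle_trans; [apply Rabs_triang|lra].
Qed.

(** Unordered convergence compares a large finite set with a fixed one; up to order,
    the large set is the fixed one followed by a remainder. *)
Lemma perm_split_incl : forall F G : list Z, NoDup F -> NoDup G -> incl G F ->
  exists H, Permutation F (G ++ H) /\ forall k, In k H -> ~ In k G.
Proof.
  intros F G HF HG HI.
  exists (filter (fun k => if in_dec Z.eq_dec k G then false else true) F).
  assert (E : forall k, In k (filter (fun k => if in_dec Z.eq_dec k G
                                 then false else true) F)
               <-> In k F /\ ~ In k G).
  { intros k. rewrite filter_In. destruct (in_dec Z.eq_dec k G); intuition congruence. }
  split; [|intros k Hk; apply E in Hk; tauto].
  apply NoDup_Permutation; trivial.
  - apply NoDup_app; trivial.
    + apply NoDup_filter; trivial.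
    + intros k Hk Hk'. apply E in Hk'. tauto.
  - intros k. rewrite in_app_iff, E.
    destruct (in_dec Z.eq_dec k G); [|tauto]. specialize (HI k). tauto.
Qed.

Lemma is_sum_Z_finite_support : forall (a : Z -> R) n,
  (forall k, (Z.of_nat n < Z.abs k)%Z -> a k = 0) ->
  is_sum_Z (V := R_NormedModule) a (rsum a (Zinterval n)).
Proof.
  intros a n H P [e He]. exists (Zinterval n). intros F HF HI. apply He.
  destruct (perm_split_incl F (Zinterval n) HF (NoDup_Zinterval n) HI) as (G & HP & HG).
  rewrite (rsum_perm _ _ _ HP), rsum_app, (rsum_zero a G), Rplus_0_r.
  - apply ball_center.
  - intros k Hk. apply H. specialize (HG k Hk). rewrite in_Zinterval in HG. lia.
Qed.

(** Absolute convergence makes the order irrelevant: once a finite set contains a long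
    symmetric interval, what it adds is bounded by the tail of the series of
    absolute values.  The symmetric sums converge because [|a|] and [|a| + a]
    are both nonnegative with bounded sums. *)
Lemma is_sum_Z_of_bounded : forall (a : Z -> R) M,
  (forall n, rsum (fun k => Rabs (a k)) (Zinterval n) <= M) ->
  exists s : R, is_sum_Z (V := R_NormedModule) a s /\
    is_lim_seq (fun n => rsum a (Zinterval n)) s.
Proof.
  intros a M HM.
  set (T := fun n => rsum (fun k => Rabs (a k)) (Zinterval n)).
  assert (TS : forall n, T n <= T (S n)).
  { intros n. unfold T. rewrite rsum_Zinterval_S.
    pose proof (Rabs_pos (a (Z.of_nat (S n)))).
    pose proof (Rabs_pos (a (- Z.of_nat (S n))%Z)). lra. }
  destruct (ex_finite_lim_seq_incr T M TS HM) as [tau Htau].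
  assert (Tle : forall n, T n <= tau)
    by (apply is_lim_seq_incr_compare; trivial).
  destruct (ex_finite_lim_seq_incr (fun n => rsum (fun k => Rabs (a k) + a k) (Zinterval n))
              (2 * M)) as [l Hl].
  { intros n. rewrite rsum_Zinterval_S.
    pose proof (Rle_abs (- a (Z.of_nat (S n)))).
    pose proof (Rle_abs (- a (- Z.of_nat (S n))%Z)).
    rewrite Rabs_Ropp in *. lra. }
  { intros n. rewrite rsum_plus. specialize (HM n).
    pose proof (Rle_abs (rsum a (Zinterval n))). pose proof (Rabs_rsum_le a (Zinterval n)). lra. }
  assert (Hs : is_lim_seq (fun n => rsum a (Zinterval n)) (l - tau)).
  { eapply is_lim_seq_ext; [|apply (is_lim_seq_minus' _ _ _ _ Hl Htau)].
    intros n. simpl. rewrite rsum_plus. unfold T. ring. }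
  exists (l - tau). split; trivial.
  intros P [e He].
  apply is_lim_seq_spec in Hs. apply is_lim_seq_spec in Htau.
  destruct (Hs (pos_div_2 e)) as [N1 H1]. destruct (Htau (pos_div_2 e)) as [N2 H2].
  set (N := (N1 + N2)%nat).
  exists (Zinterval N). intros F HF HI. apply He.
  change (Rabs (rsum a F - (l - tau)) < e).
  destruct (perm_split_incl F (Zinterval N) HF (NoDup_Zinterval N) HI) as (G & HP & HG).
  destruct (incl_Zinterval F) as [m Hm].
  destruct (perm_split_incl _ F (NoDup_Zinterval m) HF Hm) as (G' & HP' & _).
  assert (HT : T N + rsum (fun k => Rabs (a k)) G <= tau).
  { apply Rle_trans with (2 := Tle m). unfold T.
    rewrite (rsum_perm _ _ _ HP'), rsum_app, (rsum_perm _ _ _ HP), rsum_app.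
    pose proof (Rabs_rsum_le a G'). pose proof (Rabs_pos (rsum a G')). lra. }
  rewrite (rsum_perm _ _ _ HP), rsum_app.
  specialize (H1 N ltac:(unfold N; lia)). specialize (H2 N ltac:(unfold N; lia)).
  apply Rabs_lt_between in H2. simpl in H1, H2.
  pose proof (Rabs_rsum_le a G).
  replace (rsum a (Zinterval N) + rsum a G - (l - tau))
    with ((rsum a (Zinterval N) - (l - tau)) + rsum a G) by ring.
  eapply Rle_lt_trans; [apply Rabs_triang|]. lra.
Qed.

(** The tail of the series of inverse squares is compared with the telescoping
    series of [1 / (m (m + 1))], which costs a factor 2 since
    [1/m^2 <= 2 / (m (m + 1))]. *)
Lemma rsum_Zinterval_inv_sqr_bound : forall (a : Z -> R) C,
  (forall k, k <> 0%Z -> Rabs (a k) <= C / (IZR k * IZR k)) ->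
  forall n, rsum (fun k => Rabs (a k)) (Zinterval n) <= Rabs (a 0%Z) + 4 * C.
Proof.
  intros a C H.
  assert (HC : 0 <= C).
  { pose proof (H 1%Z ltac:(lia)). pose proof (Rabs_pos (a 1%Z)). lra. }
  assert (B : forall n, rsum (fun k => Rabs (a k)) (Zinterval n)
                <= Rabs (a 0%Z) + 4 * C * (1 - / (INR n + 1))).
  { induction n as [|n IH].
    - change (Rabs (a 0%Z) + 0 <= Rabs (a 0%Z) + 4 * C * (1 - / (0 + 1))).
      rewrite Rplus_0_l, Rinv_1. lra.
    - rewrite rsum_Zinterval_S.
      pose proof (H (Z.of_nat (S n)) ltac:(lia)) as H1.
      pose proof (H (- Z.of_nat (S n))%Z ltac:(lia)) as H2.
      rewrite opp_IZR in H2. rewrite <- INR_IZR_INZ in H1, H2.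
      rewrite S_INR in *. pose proof (pos_INR n). set (x := INR n) in *.
      replace (- (x + 1) * - (x + 1)) with ((x + 1) * (x + 1)) in H2 by ring.
      assert (K : 2 * (C / ((x + 1) * (x + 1)))
               <= 4 * C * (/ (x + 1) - / (x + 1 + 1))).
      { replace (4 * C * (/ (x + 1) - / (x + 1 + 1)))
          with (2 * (C / ((x + 1) * (x + 1))) * (2 * (x + 1) / (x + 1 + 1)))
          by (field; lra).
        rewrite <- (Rmult_1_r (2 * (C / _))) at 1.
        apply Rmult_le_compat_l.
        - apply Rmult_le_pos; [lra|]. apply Rmult_le_pos; [lra|].
          left. apply Rinv_0_lt_compat. nra.
        - apply (Rmult_le_reg_r (x + 1 + 1)); [lra|].
          unfold Rdiv. rewrite Rmult_assoc, Rinv_l; lra. }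
      lra. }
  intros n. eapply Rle_trans; [apply B|].
  pose proof (pos_INR n).
  assert (0 < / (INR n + 1)) by (apply Rinv_0_lt_compat; lra). nra.
Qed.

Lemma is_sum_Z_ext : forall (a b : Z -> R) (s : R), (forall k, a k = b k) ->
  is_sum_Z (V := R_NormedModule) a s -> is_sum_Z (V := R_NormedModule) b s.
Proof.
  intros a b s E H P HP. destruct (H P HP) as [F0 HF]. exists F0. intros F HN HI.
  pose proof (rsum_ext a b F E) as HE. unfold rsum in HE. rewrite <- HE. apply HF; trivial.
Qed.

(** * The Dirichlet and Fejer kernels *)

(** A crude form of Jordan's inequality: the constant only has to be positive, and 1/4
    already follows from the Taylor polynomial of degree 7 and [PI <= 4]. *)
Lemma sin_ge_quarter : forall z, 0 <= z <= PI / 2 -> z / 4 <= sin z.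
Proof.
  intros z Hz. pose proof PI_4.
  destruct (SIN z) as [H1 _]; try lra.
  (* [sin_lb] is a degree 7 Taylor polynomial, a lower bound on [0, PI]. *)
  replace (sin_lb z) with (z * (1 - z^2 / 6 + z^4/120 - z^6/5040)) in H1.
  2:{ unfold sin_lb, sin_approx, sin_term. cbn [sum_f_R0 Nat.add Nat.mul Factorial.fact].
     rewrite !INR_IZR_INZ. cbn -[pow]. field. }
  assert (z^2 <= 4) by nra.
  replace (z^4) with (z^2*z^2) in H1 by ring. replace (z^6) with (z^2*z^2*z^2) in H1 by ring.
  set (w := z^2) in *. assert (0 <= w) by (unfold w; nra).
  assert (w*w*w<=4*(w*w)) by nra.
  assert (1/4 <= (1 - w / 6 + w*w/120 - w*w*w/5040)) by nra.
  nra.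
Qed.

(** This turns the Lipschitz modulus into a multiple of [2 - 2 cos x], the factor that
    the Fejer kernel absorbs. *)
Lemma sqr_le_one_sub_cos : forall x, Rabs x <= PI -> x * x / 16 <= 2 - 2 * cos x.
Proof.
  intros x Hx.
  assert (E : 2 - 2 * cos x = 4 * (sin (x / 2) * sin (x / 2))).
  { replace x with (2 * (x / 2)) at 1 by field. rewrite cos_2a_sin. ring. }
  assert (H : Rabs x / 8 <= Rabs (sin (x / 2))).
  { unfold Rabs at 1. pose proof (sin_ge_quarter (Rabs x / 2)). pose proof (Rabs_pos x).
    destruct (Rcase_abs x) as [Hneg|Hpos].
    - rewrite Rabs_left in H by lra. replace (- x / 2) with (- (x / 2)) in H by field.
      rewrite sin_neg in H. rewrite <- Rabs_Ropp.
      rewrite Rabs_left in Hx by lra.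
      eapply Rle_trans; [|apply Rle_abs]. lra.
    - rewrite Rabs_right in H by lra. rewrite Rabs_right in Hx by lra.
      eapply Rle_trans; [|apply Rle_abs]. lra. }
  rewrite E, (Rsqr_abs x : x * x = Rabs x * Rabs x).
  pose proof (Rabs_pos x).
  replace (sin (x / 2) * sin (x / 2)) with (Rabs (sin (x / 2)) * Rabs (sin (x / 2)))
    by (rewrite <- Rabs_mult; apply Rabs_right, Rle_ge, Rle_0_sqr).
  nra.
Qed.

Definition dirichlet (n : nat) (x : R) : R := rsum (fun k => cos (IZR k * x)) (Zinterval n).

(** The sum of the first [N + 1] Dirichlet kernels, that is [N + 1] times the
    usual Fejer kernel; leaving out the division makes the telescoping plain. *)
Definition fejer (N : nat) (x : R) : R := sum_f_R0 (fun n => dirichlet n x) N.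

Lemma dirichlet_S : forall n x,
  dirichlet (S n) x = 2 * cos (INR (S n) * x) + dirichlet n x.
Proof.
  intros n x. unfold dirichlet. rewrite rsum_Zinterval_S, opp_IZR, <- INR_IZR_INZ.
  replace (- INR (S n) * x) with (- (INR (S n) * x)) by ring. rewrite cos_neg. ring.
Qed.

Lemma dirichlet_0 : forall x, dirichlet 0 x = 1.
Proof.
  intros x. change (cos (0 * x) + 0 = 1). rewrite Rmult_0_l, cos_0. ring.
Qed.

(** The closed form [sin ((n + 1/2) x) / sin (x/2)] of the kernel, multiplied by
    [4 sin^2 (x/2) = 2 - 2 cos x] so that it also holds at the zeros of [sin (x/2)]. *)
Lemma dirichlet_mul_one_sub_cos : forall n x,
  (2 - 2 * cos x) * dirichlet n x = 2 * cos (INR n * x) - 2 * cos (INR (S n) * x).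
Proof.
  intros n x. induction n as [|n IH].
  - rewrite dirichlet_0. simpl. rewrite Rmult_0_l, Rmult_1_l, cos_0. ring.
  - rewrite dirichlet_S, Rmult_plus_distr_l, IH.
    rewrite !S_INR.
    replace ((INR n + 1 + 1) * x) with ((INR n + 1) * x + x) by ring.
    replace (INR n * x) with ((INR n + 1) * x - x) by ring.
    rewrite cos_plus, cos_minus. ring.
Qed.

Lemma fejer_mul_one_sub_cos : forall N x,
  (2 - 2 * cos x) * fejer N x = 2 - 2 * cos (INR (S N) * x).
Proof.
  intros N x. unfold fejer. induction N as [|N IH]; cbn [sum_f_R0].
  - rewrite dirichlet_mul_one_sub_cos. simpl. rewrite Rmult_0_l, cos_0. ring.
  - rewrite Rmult_plus_distr_l, IH, dirichlet_mul_one_sub_cos. ring.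
Qed.

(** Away from 0 divide the previous identity by [2 - 2 cos x > 0]; at 0 every cosine
    is 1.  Other multiples of [2 PI] are excluded by the bound on [x]. *)
Lemma fejer_nonneg : forall N x, Rabs x <= PI -> 0 <= fejer N x.
Proof.
  intros N x Hx. destruct (Req_dec x 0) as [->|Hne].
  - apply cond_pos_sum. intros n. induction n as [|n IH].
    + rewrite dirichlet_0. lra.
    + rewrite dirichlet_S, Rmult_0_r, cos_0. lra.
  - pose proof (sqr_le_one_sub_cos x Hx). pose proof (fejer_mul_one_sub_cos N x).
    pose proof (COS_bound (INR (S N) * x)).
    assert (0 < x * x) by nra.
    apply (Rmult_le_reg_l (2 - 2 * cos x)); lra.
Qed.

Lemma is_RInt_cst : forall a b c : R, is_RInt (fun _ => c) a b ((b - a) * c).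
Proof. intros a b c. exact (is_RInt_const a b c). Qed.

Lemma is_RInt_rsum : forall (g : Z -> R -> R) (l : Z -> R) a b F,
  (forall k, is_RInt (g k) a b (l k)) ->
  is_RInt (fun x => rsum (fun k => g k x) F) a b (rsum l F).
Proof.
  intros g l a b F H. induction F as [|k F IH].
  - change (is_RInt (fun _ : R => 0) a b 0).
    pose proof (is_RInt_cst a b 0) as H0. rewrite Rmult_0_r in H0. exact H0.
  - apply (is_RInt_plus (g k) _ a b (l k) (rsum l F)); trivial.
Qed.

Lemma is_RInt_sum_f_R0 : forall (g : nat -> R -> R) (l : nat -> R) a b N,
  (forall n, is_RInt (g n) a b (l n)) ->
  is_RInt (fun x => sum_f_R0 (fun n => g n x) N) a b (sum_f_R0 l N).
Proof.
  intros g l a b N H. induction N as [|N IH]; cbn [sum_f_R0]; trivial.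
  apply (is_RInt_plus (fun x => sum_f_R0 (fun n => g n x) N)); trivial.
Qed.

Lemma continuous_rsum : forall (g : Z -> R -> R) F x,
  (forall k, continuous (g k) x) ->
  continuous (fun x => rsum (fun k => g k x) F) x.
Proof.
  intros g F x H. induction F as [|k F IH].
  - apply (continuous_const (0 : R)).
  - apply (continuous_plus (g k)); trivial.
Qed.

Lemma continuous_dirichlet : forall n c d x,
  continuous (fun y => dirichlet n (c * (y + d))) x.
Proof.
  intros n c d x. apply (continuous_rsum (fun k y => cos (IZR k * (c * (y + d))))).
  intros k. apply @ex_derive_continuous. auto_derive. trivial.
Qed.

(** Only the constant term [k = 0] has a nonzero integral over a period. *)
Lemma is_RInt_dirichlet : forall u n, 0 < u ->
  is_RInt (fun y => dirichlet n (2 * PI / u * y)) (- (u / 2)) (u / 2) u.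
Proof.
  intros u n Hu. pose proof PI_RGT_0.
  set (l := fun k : Z => if Z.eq_dec k 0 then u else 0).
  cut (is_RInt (fun y => dirichlet n (2 * PI / u * y)) (- (u / 2)) (u / 2) (rsum l (Zinterval n))).
  - intros H0. replace (rsum l (Zinterval n)) with u in H0; [exact H0|]. clear H0. symmetry.
    induction n as [|n IH].
    + change (l 0%Z + 0 = u). unfold l. simpl. ring.
    + rewrite rsum_Zinterval_S, IH. unfold l.
      destruct (Z.eq_dec _ 0); [lia|]. destruct (Z.eq_dec _ 0); [lia|]. ring.
  - apply is_RInt_rsum. intros k. unfold l. destruct (Z.eq_dec k 0) as [->|Hk].
    + apply (is_RInt_ext (fun _ => 1)).
      * intros y _. rewrite Rmult_0_l, cos_0. reflexivity.
      * pose proof (is_RInt_cst (- (u / 2)) (u / 2) 1) as H0.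
        replace ((u / 2 - - (u / 2)) * 1) with u in H0 by field. exact H0.
    + assert (Hk' : IZR k <> 0) by (apply not_0_IZR; trivial).
      set (G := fun y => u / (2 * PI * IZR k) * sin (IZR k * (2 * PI / u * y))).
      assert (E : minus (G (u / 2)) (G (- (u / 2))) = 0).
      { unfold G, minus, plus, opp; simpl.
        replace (IZR k * (2 * PI / u * (u / 2))) with (IZR k * PI) by (field; lra).
        replace (IZR k * (2 * PI / u * - (u / 2))) with (- (IZR k * PI)) by (field; lra).
        rewrite sin_neg, (sin_eq_0_1 (IZR k * PI)) by (exists k; trivial). ring. }
      rewrite <- E. apply (is_RInt_derive G).
      * intros y _. unfold G. auto_derive; trivial. field. repeat split; lra.
      * intros y _. apply @ex_derive_continuous. auto_derive. trivial.
Qed.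

(** Fejer's theorem at the centre of one period.  The means are written with [pred n]
    and [INR n], the form in which [Cesaro_1] gives them. *)
Lemma fejer_convergence : forall (f : R -> R) u L, 0 < u ->
  (forall y, continuous f y) ->
  (forall y, Rabs y <= u / 2 -> Rabs (f y - f 0) <= L * Rabs y) ->
  Un_cv (fun n => sum_f_R0 (fun m => / u * RInt (fun y => f y * dirichlet m (2 * PI / u * y))
                                             (- (u / 2)) (u / 2)) (pred n) / INR n) (f 0).
Proof.
  intros f u L Hu Hf HL. pose proof PI_RGT_0 as Hpi.
  set (J := fun m => / u * RInt (fun y => f y * dirichlet m (2 * PI / u * y))
                                             (- (u / 2)) (u / 2)).
  assert (HJ : forall N, is_RInt (fun y => f y * fejer N (2 * PI / u * y))
                  (- (u / 2)) (u / 2) (u * sum_f_R0 J N)).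
  { intros N. rewrite scal_sum.
    apply (is_RInt_ext (fun y => sum_f_R0 (fun m => f y * dirichlet m (2 * PI / u * y)) N)).
    { intros y _. unfold fejer. rewrite scal_sum. apply sum_eq. intros; ring. }
    apply is_RInt_sum_f_R0. intros m. unfold J.
    assert (E : forall I : R, / u * I * u = I) by (intros; field; lra).
    rewrite E.
    apply (@RInt_correct R_CompleteNormedModule). apply @ex_RInt_continuous.
    intros y _. apply (continuous_mult f); [apply Hf|].
    apply (continuous_ext (fun y => dirichlet m (2 * PI / u * (y + 0)))).
    - intros z. rewrite Rplus_0_r. reflexivity.
    - apply continuous_dirichlet. }
  assert (HQ : forall N, is_RInt (fun y => fejer N (2 * PI / u * y))
                  (- (u / 2)) (u / 2) (INR (S N) * u)).
  { intros N. rewrite (Rmult_comm (INR _)), <- sum_cte.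
    apply is_RInt_sum_f_R0. intros m. apply is_RInt_dirichlet; trivial. }
  intros eps Heps.
  (* By the arithmetic-geometric mean inequality, [L |y|] is at most
     [eps/2 + L^2 y^2 / (2 eps)], and [sqr_le_one_sub_cos] at
     [x = 2 PI y / u] bounds [y^2]; [M] collects the constants. *)
  set (M := 16 * (L * L) * (u * u) / (2 * eps * (4 * (PI * PI)))).
  assert (HM : 0 <= M).
  { unfold M. apply Rmult_le_pos; [apply Rmult_le_pos; nra|].
    left. apply Rinv_0_lt_compat. apply Rmult_lt_0_compat; nra. }
  assert (Hmod : forall y, Rabs y <= u / 2 ->
    Rabs (2 * PI / u * y) <= PI /\
    Rabs (f y - f 0) <= eps / 2 + M * (2 - 2 * cos (2 * PI / u * y))).
  { intros y Hy.
    assert (Hx : Rabs (2 * PI / u * y) <= PI).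
    { rewrite Rabs_mult, (Rabs_right (2 * PI / u)).
      - apply (Rmult_le_reg_r (u / (2 * PI))).
        + apply Rdiv_lt_0_compat; lra.
        + replace (2 * PI / u * Rabs y * (u / (2 * PI))) with (Rabs y) by (field; lra).
          replace (PI * (u / (2 * PI))) with (u / 2) by (field; lra). trivial.
      - apply Rle_ge, Rlt_le, Rdiv_lt_0_compat; lra. }
    split; trivial.
    apply Rle_trans with (1 := HL y Hy).
    apply Rle_trans with (eps / 2 + (L * L) / (2 * eps) * (y * y)).
    - rewrite (Rsqr_abs y : y * y = Rabs y * Rabs y). set (r := Rabs y).
      assert (0 <= (eps - L * r) * (eps - L * r) / (2 * eps)).
      { apply Rmult_le_pos; [apply Rle_0_sqr|]. left. apply Rinv_0_lt_compat. lra. }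
      replace (eps / 2 + L * L / (2 * eps) * (r * r))
        with ((eps - L * r) * (eps - L * r) / (2 * eps) + L * r) by (field; lra).
      lra.
    - apply Rplus_le_compat_l.
      apply Rle_trans with (M * ((2 * PI / u * y) * (2 * PI / u * y) / 16)).
      + right. unfold M. field. repeat split; lra.
      + apply Rmult_le_compat_l; trivial. apply sqr_le_one_sub_cos; trivial. }
  assert (Hbd : forall N, Rabs (sum_f_R0 J N / INR (S N) - f 0)
                   <= eps / 2 + 4 * M / INR (S N)).
  { intros N.
    assert (B : norm (u * sum_f_R0 J N - f 0 * (INR (S N) * u))
                <= eps / 2 * (INR (S N) * u) + 4 * M * u).
    { apply (norm_RInt_le (fun y => f y * fejer N (2 * PI / u * y)
                              - f 0 * fejer N (2 * PI / u * y))
               (fun y => eps / 2 * fejer N (2 * PI / u * y) + 4 * M)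
               (- (u / 2)) (u / 2)).
      - lra.
      - intros y Hy. destruct (Hmod y) as [Hx Hfy]; [apply Rabs_le; lra|].
        change (norm ?x) with (Rabs x).
        rewrite <- Rmult_minus_distr_r, Rabs_mult.
        pose proof (fejer_nonneg N _ Hx) as Hpos.
        rewrite (Rabs_right (fejer _ _)) by lra.
        pose proof (fejer_mul_one_sub_cos N (2 * PI / u * y)) as Hmul.
        pose proof (COS_bound (INR (S N) * (2 * PI / u * y))).
        eapply Rle_trans; [apply Rmult_le_compat_r; [exact Hpos|exact Hfy]|].
        rewrite Rmult_plus_distr_r, Rmult_assoc, Hmul. nra.
      - apply (is_RInt_minus (fun y => f y * fejer N (2 * PI / u * y))).
        + apply HJ.
        + apply (is_RInt_scal (fun y => fejer N (2 * PI / u * y)) _ _ (f 0)). apply HQ.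
      - apply (is_RInt_plus (fun y => eps / 2 * fejer N (2 * PI / u * y))).
        + apply (is_RInt_scal (fun y => fejer N (2 * PI / u * y)) _ _ (eps / 2)). apply HQ.
        + replace (4 * M * u) with ((u / 2 - - (u / 2)) * (4 * M)) by field.
          apply is_RInt_cst. }
    change (norm ?x) with (Rabs x) in B.
    assert (HN : 0 < INR (S N)) by (apply lt_0_INR; lia).
    replace (sum_f_R0 J N / INR (S N) - f 0)
      with ((u * sum_f_R0 J N - f 0 * (INR (S N) * u)) * / (INR (S N) * u))
      by (field; lra).
    rewrite Rabs_mult, (Rabs_right (/ _))
      by (apply Rle_ge, Rlt_le, Rinv_0_lt_compat; nra).
    replace (eps / 2 + 4 * M / INR (S N))
      with ((eps / 2 * (INR (S N) * u) + 4 * M * u) * / (INR (S N) * u))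
      by (field; lra).
    apply Rmult_le_compat_r; trivial. left. apply Rinv_0_lt_compat. nra. }
  destruct (INR_archimed (eps / 2) (4 * M)) as [n0 Hn0]; [lra|].
  exists (S n0). intros n Hn. destruct n as [|N]; [lia|].
  cbn [pred]. unfold Rdist.
  eapply Rle_lt_trans; [apply Hbd|].
  assert (HN : INR n0 <= INR (S N)) by (apply le_INR; lia).
  assert (HN' : 0 < INR (S N)) by (apply lt_0_INR; lia).
  assert (4 * M / INR (S N) < eps / 2).
  { apply (Rmult_lt_reg_r (INR (S N))); trivial.
    unfold Rdiv at 1. rewrite Rmult_assoc, Rinv_l by lra. nra. }
  lra.
Qed.

Lemma cos_period_Z : forall x k, cos (x + 2 * IZR k * PI) = cos x.
Proof.
  intros x k. destruct (Z_le_gt_dec 0 k) as [Hk|Hk].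
  - rewrite <- (Z2Nat.id k Hk), <- INR_IZR_INZ. apply cos_period.
  - rewrite <- (cos_period (x + 2 * IZR k * PI) (Z.to_nat (- k))).
    rewrite INR_IZR_INZ, Z2Nat.id, opp_IZR by lia. f_equal. ring.
Qed.

Lemma dirichlet_period : forall n x j,
  dirichlet n (x + 2 * IZR j * PI) = dirichlet n x.
Proof.
  intros n x j. apply rsum_ext. intros k.
  rewrite <- (cos_period_Z (IZR k * x) (k * j)), mult_IZR. f_equal. ring.
Qed.

(** The windows of length [u] centred at [t + u j], [|j| <= K], tile an interval
    centred at [t]; each step of the induction adds one window at either end. *)
Lemma RInt_periods : forall (g : R -> R) t u K,
  (forall x, continuous g x) ->
  is_RInt g (t - u / 2 - u * INR K) (t + u / 2 + u * INR K)
    (rsum (fun j => RInt (fun y => g (y + (t + u * IZR j))) (- (u / 2)) (u / 2)) (Zinterval K)).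
Proof.
  intros g t u K Hg.
  assert (P : forall c, is_RInt g (c - u / 2) (c + u / 2)
                (RInt (fun y => g (y + c)) (- (u / 2)) (u / 2))).
  { intros c.
    assert (E : ex_RInt g (c - u / 2) (c + u / 2))
      by (apply @ex_RInt_continuous; intros; apply Hg).
    replace (RInt (fun y => g (y + c)) (- (u / 2)) (u / 2)) with (RInt g (c - u / 2) (c + u / 2)).
    - apply (@RInt_correct R_CompleteNormedModule). trivial.
    - replace (c - u / 2) with (1 * - (u / 2) + c) in * by ring.
      replace (c + u / 2) with (1 * (u / 2) + c) in * by ring.
      rewrite <- RInt_comp_lin by trivial. apply RInt_ext.
      intros y _. unfold scal; simpl; unfold mult; simpl. rewrite !Rmult_1_l. reflexivity. }
  induction K as [|K IH].
  - specialize (P t). simpl.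
    replace (t - u / 2 - u * 0) with (t - u / 2) by ring.
    replace (t + u / 2 + u * 0) with (t + u / 2) by ring.
    unfold rsum, sum_list. simpl. rewrite plus_zero_r, Rmult_0_r, Rplus_0_r. exact P.
  - rewrite rsum_Zinterval_S, opp_IZR, <- INR_IZR_INZ.
    pose proof (P (t + u * INR (S K))) as P1. pose proof (P (t + u * - INR (S K))) as P2.
    rewrite S_INR in *.
    replace (t + u * - (INR K + 1) + u / 2) with (t - u / 2 - u * INR K) in P2 by field.
    replace (t + u * (INR K + 1) - u / 2) with (t + u / 2 + u * INR K) in P1 by field.
    replace (t - u / 2 - u * (INR K + 1)) with (t + u * - (INR K + 1) - u / 2) by ring.
    replace (t + u / 2 + u * (INR K + 1)) with (t + u * (INR K + 1) + u / 2) by ring.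
    pose proof (is_RInt_Chasles _ _ _ _ _ _ (is_RInt_Chasles _ _ _ _ _ _ P2 IH) P1) as H.
    unfold plus in H; simpl in H.
    rewrite (Rplus_comm (_ + _) (rsum _ _)), <- (Rplus_comm _ (RInt _ _ _)), <- Rplus_assoc.
    rewrite (Rplus_comm (rsum _ _)). exact H.
Qed.

(** * Cosine integrals and decay of the Fourier coefficients *)

(** Extensionality of the integral leaves equations in the carrier of a normed module,
    which [ring] does not recognise as [R]. *)
Ltac in_R := match goal with |- @eq _ ?x ?y => change (@eq R x y) end.

(** With a free phase [th], one integral covers the cosine ([th = 0]) and the
    sine ([th = PI / 2], up to sign) and all their translates. *)
Definition cosint (f : R -> R) (a b w th : R) : R :=
  RInt (fun x => f x * cos (w * x + th)) a b.

Lemma is_RInt_cosint : forall (f : R -> R) a b w th, (forall x, continuous f x) ->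
  is_RInt (fun x => f x * cos (w * x + th)) a b (cosint f a b w th).
Proof.
  intros f a b w th Hf. apply (@RInt_correct R_CompleteNormedModule).
  apply @ex_RInt_continuous. intros x _. apply (continuous_mult f); [apply Hf|].
  apply @ex_derive_continuous. auto_derive. trivial.
Qed.

Lemma cosint_phase : forall (f : R -> R) a b w th, (forall x, continuous f x) ->
  cosint f a b w th = cos th * cosint f a b w 0 + sin th * cosint f a b w (PI / 2).
Proof.
  intros f a b w th Hf. apply (@is_RInt_unique R_CompleteNormedModule).
  apply (is_RInt_ext (fun x => cos th * (f x * cos (w * x + 0))
                         + sin th * (f x * cos (w * x + PI / 2)))).
  { intros x _. in_R. rewrite !cos_plus, cos_0, sin_0, cos_PI2, sin_PI2. ring. }
  apply (is_RInt_plus (fun x => cos th * (f x * cos (w * x + 0)))).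
  - apply (is_RInt_scal (fun x => f x * cos (w * x + 0)) _ _ (cos th)).
    apply is_RInt_cosint; trivial.
  - apply (is_RInt_scal (fun x => f x * cos (w * x + PI / 2)) _ _ (sin th)).
    apply is_RInt_cosint; trivial.
Qed.

(** Both integrations by parts at once: the derivative of
    [f sin/w + f1 cos/w^2] is [f cos + f2 cos/w^2], because the two terms in
    [f1 sin] cancel, and this primitive vanishes at the endpoints. *)
Lemma cosint_decay : forall (f f1 f2 : R -> R) a b B w th,
  (forall x, is_derive f x (f1 x)) -> (forall x, is_derive f1 x (f2 x)) ->
  (forall x, continuous f2 x) ->
  a <= b -> f a = 0 -> f b = 0 -> f1 a = 0 -> f1 b = 0 ->
  (forall x, a <= x <= b -> Rabs (f2 x) <= B) -> w <> 0 ->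
  Rabs (cosint f a b w th) <= (b - a) * B / (w * w).
Proof.
  intros f f1 f2 a b B w th D1 D2 C2 Hab fa fb f1a f1b HB Hw.
  assert (C0 : forall x, continuous f x)
    by (intros x; apply @ex_derive_continuous; eexists; apply D1).
  set (G := fun x => f x * sin (w * x + th) / w + f1 x * cos (w * x + th) / (w * w)).
  assert (H : is_RInt (fun x => f x * cos (w * x + th) + / (w * w) * (f2 x * cos (w * x + th)))
                a b (minus (G b) (G a))).
  { apply (is_RInt_derive G).
    - intros x _. unfold G. auto_derive.
      + repeat split; trivial; eexists; [apply D1|apply D2].
      + replace (Derive (fun x => f x) x) with (f1 x)
          by (symmetry; apply is_derive_unique, D1).
        replace (Derive (fun x => f1 x) x) with (f2 x)
          by (symmetry; apply is_derive_unique, D2).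
        field. trivial.
    - intros x _. apply (continuous_plus (fun x => f x * cos (w * x + th))).
      + apply (continuous_mult f); [apply C0|].
        apply @ex_derive_continuous. auto_derive. trivial.
      + apply (continuous_mult (fun _ => / (w * w))); [apply continuous_const|].
        apply (continuous_mult f2); [apply C2|].
        apply @ex_derive_continuous. auto_derive. trivial. }
  replace (minus (G b) (G a)) with 0 in H.
  2:{ unfold G, minus, plus, opp; simpl. rewrite fa, fb, f1a, f1b. field. trivial. }
  pose proof (is_RInt_plus _ _ _ _ _ _ (is_RInt_cosint f a b w th C0)
     (is_RInt_scal _ _ _ (/ (w * w)) _ (is_RInt_cosint f2 a b w th C2))) as H'.
  pose proof (@is_RInt_unique R_CompleteNormedModule _ _ _ _ H) as E1.
  pose proof (@is_RInt_unique R_CompleteNormedModule _ _ _ _ H') as E2.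
  assert (E : cosint f a b w th = - (/ (w * w) * cosint f2 a b w th)).
  { assert (E : 0 = cosint f a b w th + / (w * w) * cosint f2 a b w th)
      by (rewrite <- E1; exact E2). lra. }
  assert (Hww : 0 < w * w) by nra.
  rewrite E, Rabs_Ropp, Rabs_mult, (Rabs_right (/ _))
    by (apply Rle_ge, Rlt_le, Rinv_0_lt_compat; trivial).
  unfold Rdiv. rewrite Rmult_comm.
  apply Rmult_le_compat_r; [left; apply Rinv_0_lt_compat; trivial|].
  apply abs_RInt_le_const; trivial.
  - eexists. apply is_RInt_cosint; trivial.
  - intros x Hx. rewrite Rabs_mult, <- (Rmult_1_r B).
    apply Rmult_le_compat; auto using Rabs_pos. apply Rabs_le, COS_bound.
Qed.

Lemma cesaro_rsum : forall (J : Z -> nat -> R) (l : Z -> R) F,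
  (forall j, Un_cv (fun n => sum_f_R0 (J j) (pred n) / INR n) (l j)) ->
  Un_cv (fun n => sum_f_R0 (fun m => rsum (fun j => J j m) F) (pred n) / INR n) (rsum l F).
Proof.
  intros J l F H. induction F as [|j F IH].
  - intros e He. exists O. intros n _.
    change (Rabs (sum_f_R0 (fun _ => 0) (pred n) / INR n - 0) < e).
    rewrite sum_cte.
    unfold Rdiv. rewrite !Rmult_0_l, Rminus_0_r, Rabs_R0. trivial.
  - apply is_lim_seq_Reals.
    apply (is_lim_seq_ext (fun n => sum_f_R0 (J j) (pred n) / INR n +
             sum_f_R0 (fun m => rsum (fun j => J j m) F) (pred n) / INR n)).
    + intros n. rewrite <- Rdiv_plus_distr, <- plus_sum. reflexivity.
    + apply (is_lim_seq_plus' _ _ (l j) (rsum l F)); apply is_lim_seq_Reals; trivial.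
Qed.

(** * Poisson summation for the real and imaginary parts *)

Lemma derivative_vanishes_off_support : forall (f f1 : R -> R) A,
  (forall x, is_derive f x (f1 x)) -> (forall x, A < Rabs x -> f x = 0) ->
  forall x, A < Rabs x -> f1 x = 0.
Proof.
  intros f f1 A D1 H x Hx.
  rewrite <- (is_derive_unique _ _ _ (D1 x)).
  rewrite (Derive_ext_loc f (fun _ => 0)); [apply Derive_const|].
  assert (He : 0 < Rabs x - A) by lra.
  exists (mkposreal _ He). intros y Hy. apply H.
  change (Rabs (y - x) < Rabs x - A) in Hy.
  pose proof (Rabs_triang_inv x y). rewrite Rabs_minus_sym in Hy. lra.
Qed.

Lemma lipschitz_near : forall (f f1 : R -> R) c r,
  (forall x, is_derive f x (f1 x)) -> (forall x, continuous f1 x) ->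
  exists L, forall y, Rabs y <= r -> Rabs (f (y + c) - f c) <= L * Rabs y.
Proof.
  intros f f1 c r D1 C1.
  destruct (bounded_continuity f1 (c - r) (c + r)) as [L HL]; [intros; apply C1|].
  exists L. intros y Hy. replace y with ((y + c) - c) at 2 by ring.
  apply bounded_variation with f1. intros x Hx. split; [apply D1|].
  left. apply HL. replace (y + c - c) with y in Hx by ring.
  pose proof (Rle_trans _ _ _ Hx Hy) as H. apply Rabs_le_between in H. lra.
Qed.

(** The interval [[a, b]] is the union of the [2 K + 1] windows of length [u] around the
    points [t + u j]; the condition on [K] makes it contain the support of [f] in its
    interior.  The phases [- w t] and [PI/2 - w t] give
    [cos (w (x - t))] and [- sin (w (x - t))]. *)
Lemma poisson_components : forall (f f1 f2 : R -> R) A u t K,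
  (forall x, is_derive f x (f1 x)) -> (forall x, is_derive f1 x (f2 x)) ->
  (forall x, continuous f2 x) -> (forall x, A < Rabs x -> f x = 0) ->
  0 < u -> A + Rabs t <= u * INR K ->
  let a := t - u / 2 - u * INR K in let b := t + u / 2 + u * INR K in
  let w := fun k => 2 * PI / u * IZR k in
  is_sum_Z (V := R_NormedModule) (fun k => / u * cosint f a b (w k) (- (w k * t)))
    (rsum (fun j => f (t + u * IZR j)) (Zinterval K)) /\
  is_sum_Z (V := R_NormedModule) (fun k => / u * cosint f a b (w k) (PI / 2 - w k * t)) 0.
Proof.
  intros f f1 f2 A u t K D1 D2 C2 HA Hu HK a b w.
  pose proof PI_RGT_0 as Hpi.
  assert (C0 : forall x, continuous f x)
    by (intros x; apply @ex_derive_continuous; eexists; apply D1).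
  assert (C1 : forall x, continuous f1 x)
    by (intros x; apply @ex_derive_continuous; eexists; apply D2).
  pose proof (derivative_vanishes_off_support f f1 A D1 HA) as HA1.
  pose proof (Rle_abs t) as Ht1. pose proof (Rle_abs (- t)) as Ht2. rewrite Rabs_Ropp in Ht2.
  pose proof (pos_INR K) as HK0.
  assert (Ha : A < Rabs a).
  { pose proof (Rle_abs (- a)). rewrite Rabs_Ropp in H. unfold a in *. lra. }
  assert (Hb : A < Rabs b) by (pose proof (Rle_abs b); unfold b in *; lra).
  assert (Hab : a <= b) by (unfold a, b; nra).
  destruct (bounded_continuity f2 a b) as [B HB]; [intros; apply C2|].
  assert (Hsum : forall th : Z -> R, exists s : R,
     is_sum_Z (V := R_NormedModule) (fun k => / u * cosint f a b (w k) (th k)) s /\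
     is_lim_seq (fun n => rsum (fun k => / u * cosint f a b (w k) (th k)) (Zinterval n)) s).
  { intros th. eapply is_sum_Z_of_bounded. apply rsum_Zinterval_inv_sqr_bound with
      (C := / u * ((b - a) * B / ((2 * PI / u) * (2 * PI / u)))).
    intros k Hk. apply not_0_IZR in Hk.
    rewrite Rabs_mult, (Rabs_right (/ u)) by (apply Rle_ge, Rlt_le, Rinv_0_lt_compat; trivial).
    replace (/ u * ((b - a) * B / ((2 * PI / u) * (2 * PI / u))) / (IZR k * IZR k))
      with (/ u * ((b - a) * B / (w k * w k))) by (unfold w; field; repeat split; lra).
    apply Rmult_le_compat_l; [left; apply Rinv_0_lt_compat; trivial|].
    apply cosint_decay with f1 f2; auto.
    - intros x Hx. left. apply HB. trivial.
    - unfold w. apply Rmult_integral_contrapositive_currified; trivial.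
      apply Rgt_not_eq, Rdiv_lt_0_compat; lra. }
  split.
  - destruct (Hsum (fun k => - (w k * t))) as (s & Hs & Hlim).
    replace (rsum (fun j => f (t + u * IZR j)) (Zinterval K)) with s; trivial.
    (* The limit of the symmetric sums exists, so it is determined by their
       Cesaro means. *)
    apply is_lim_seq_Reals, Cesaro_1 in Hlim.
    eapply UL_sequence; [exact Hlim|].
    set (J := fun j m => / u * RInt (fun y => f (y + (t + u * IZR j))
                              * dirichlet m (2 * PI / u * y)) (- (u / 2)) (u / 2)).
    assert (E : forall m, rsum (fun k => / u * cosint f a b (w k) (- (w k * t))) (Zinterval m)
                     = rsum (fun j => J j m) (Zinterval K)).
    { intros m. unfold J. rewrite !rsum_mult_l. f_equal.
      pose proof (is_RInt_rsum (fun k x => f x * cos (w k * x + - (w k * t))) _ a b (Zinterval m)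
                   (fun k => is_RInt_cosint f a b (w k) (- (w k * t)) C0)) as H1.
      pose proof (RInt_periods (fun x => f x * dirichlet m (2 * PI / u * (x + - t))) t u K) as H2.
      refine (eq_trans (eq_sym (@is_RInt_unique R_CompleteNormedModule _ _ _ _ H1)) _).
      apply (@is_RInt_unique R_CompleteNormedModule).
      eapply is_RInt_ext.
      2:{ erewrite rsum_ext; [apply H2|].
          - intros x. apply (continuous_mult f); [apply C0|]. apply continuous_dirichlet.
          - intros j. apply RInt_ext. intros y _. simpl. f_equal.
            rewrite <- (dirichlet_period m (2 * PI / u * y) j). f_equal. field. lra. }
      (* Summing the cosines over [k] before integrating produces the kernel. *)
      intros x _. simpl. unfold dirichlet. rewrite <- rsum_mult_l. apply rsum_ext.
      intros k. f_equal. f_equal. unfold w. ring. }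
    eapply Un_cv_ext; [|apply (cesaro_rsum J (fun j => f (t + u * IZR j)) (Zinterval K))].
    + intros n. simpl. f_equal. apply sum_eq. intros m _. symmetry. apply E.
    + intros j. unfold J. destruct (lipschitz_near f f1 (t + u * IZR j) (u / 2) D1 C1) as [L HL].
      pose proof (fejer_convergence (fun y => f (y + (t + u * IZR j))) u L Hu) as H.
      simpl in H. rewrite Rplus_0_l in H. apply H; trivial.
      intros y. apply (continuous_comp (fun y => y + (t + u * IZR j)) f); [|apply C0].
      apply @ex_derive_continuous. auto_derive. trivial.
  - destruct (Hsum (fun k => PI / 2 - w k * t)) as (s & Hs & Hlim).
    (* The imaginary parts are odd in [k], so the symmetric sums are all zero. *)
    assert (Hodd : forall k, cosint f a b (w (- k)%Z) (PI / 2 - w (- k)%Z * t)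
                      = - cosint f a b (w k) (PI / 2 - w k * t)).
    { intros k. apply (@is_RInt_unique R_CompleteNormedModule).
      eapply is_RInt_ext; [|apply (is_RInt_opp _ _ _ _ (is_RInt_cosint f a b (w k)
                               (PI / 2 - w k * t) C0))].
      intros x _. unfold opp; simpl. in_R. unfold w. rewrite opp_IZR.
      replace (2 * PI / u * - IZR k * x + (PI / 2 - 2 * PI / u * - IZR k * t))
        with (PI / 2 - (2 * PI / u * IZR k * (x - t))) by ring.
      replace (2 * PI / u * IZR k * x + (PI / 2 - 2 * PI / u * IZR k * t))
        with (PI / 2 + (2 * PI / u * IZR k * (x - t))) by ring.
      rewrite cos_minus, cos_plus, cos_PI2. ring. }
    replace 0 with s; trivial.
    assert (Hz : is_lim_seq (fun n => rsum (fun k => / u * cosint f a b (w k)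
                                  (PI / 2 - w k * t)) (Zinterval n)) 0).
    { apply (is_lim_seq_ext (fun _ => 0)); [|apply is_lim_seq_const].
      intros n. rewrite rsum_mult_l. symmetry. apply Rmult_eq_0_compat_l.
      induction n as [|n IH].
      - pose proof (Hodd 0%Z) as H. simpl Z.opp in H.
        change (cosint f a b (w 0%Z) (PI / 2 - w 0%Z * t) + 0 = 0). lra.
      - rewrite rsum_Zinterval_S, IH, Hodd. ring. }
    apply is_lim_seq_unique in Hz. apply is_lim_seq_unique in Hlim.
    rewrite Hlim in Hz. congruence.
Qed.

(** * The Fourier transform and the complex series *)

Lemma sum_list_C : forall (c : Z -> C) F,
  sum_list (V := C_R_NormedModule) c F
  = (rsum (fun k => Re (c k)) F, rsum (fun k => Im (c k)) F).
Proof.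
  intros c F. induction F as [|k F IH]; [reflexivity|].
  change (Cplus (c k) (sum_list (V := C_R_NormedModule) c F)
    = (Re (c k) + rsum (fun k => Re (c k)) F, Im (c k) + rsum (fun k => Im (c k)) F)).
  rewrite IH. reflexivity.
Qed.

Lemma is_sum_Z_C : forall (c : Z -> C) (x y : R),
  is_sum_Z (V := R_NormedModule) (fun k => Re (c k)) x ->
  is_sum_Z (V := R_NormedModule) (fun k => Im (c k)) y ->
  is_sum_Z (V := C_R_NormedModule) c (x, y).
Proof.
  intros c x y Hx Hy P [e He].
  destruct (Hx (ball x e)) as [F1 H1]; [apply locally_ball|].
  destruct (Hy (ball y e)) as [F2 H2]; [apply locally_ball|].
  exists (F1 ++ F2). intros F HF HI. apply incl_app_inv in HI. destruct HI as [I1 I2].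
  apply He. rewrite sum_list_C. split; [apply H1|apply H2]; trivial.
Qed.

Lemma is_RInt_extend : forall (g : R -> R) A a b a' b' l,
  (forall x, A < Rabs x -> g x = 0) ->
  a < - A -> A < b -> a' < - A -> A < b' ->
  is_RInt g a b l -> is_RInt g a' b' l.
Proof.
  intros g A a b a' b' l Hg Ha Hb Ha' Hb' H.
  assert (Z : forall p q, (forall x, Rmin p q < x < Rmax p q -> g x = 0) ->
                is_RInt g p q 0).
  { intros p q Hpq. apply (is_RInt_ext (fun _ => 0)).
    - intros x Hx. symmetry. apply Hpq. trivial.
    - pose proof (is_RInt_cst p q 0) as H0. rewrite Rmult_0_r in H0. exact H0. }
  assert (Z1 : is_RInt g a' a 0).
  { apply Z. intros x [_ Hx]. apply Hg. pose proof (Rle_abs (- x)). rewrite Rabs_Ropp in H0.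
    pose proof (Rmax_lub_lt a' a (- A) Ha' Ha). lra. }
  assert (Z2 : is_RInt g b b' 0).
  { apply Z. intros x [Hx _]. apply Hg. pose proof (Rle_abs x).
    pose proof (Rmin_glb_lt b b' A Hb Hb'). lra. }
  pose proof (is_RInt_Chasles _ _ _ _ _ _ (is_RInt_Chasles _ _ _ _ _ _ Z1 H) Z2) as H0.
  unfold plus in H0; simpl in H0. rewrite Rplus_0_r, Rplus_0_l in H0. exact H0.
Qed.

Lemma Cexp_i : forall x : R, Cexp (0, x) = (cos x, sin x).
Proof.
  intros x. unfold Cexp. simpl. rewrite exp_0, !Rmult_1_l. reflexivity.
Qed.

(** For a function of compact support the improper integral is eventually constant in
    its bounds, hence equal to the integral over any interval around the support. *)
Lemma Fourier_cosint : forall (f : R -> R) A a b xi,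
  (forall x, continuous f x) -> (forall x, A < Rabs x -> f x = 0) ->
  a < - A -> A < b ->
  Fourier f (RtoC xi) = (cosint f a b (2 * PI * xi) 0, cosint f a b (2 * PI * xi) (PI / 2)).
Proof.
  intros f A a b xi C0 HA Ha Hb. unfold Fourier.
  refine (@is_RInt_gen_unique C_R_CompleteNormedModule _ _ _ _ _ _ _).
  intros P HP.
  exists (fun x => x < - A) (fun x => A < x).
  - exists (- A). trivial.
  - exists A. trivial.
  - intros p q Hp Hq. simpl.
    exists (cosint f a b (2 * PI * xi) 0, cosint f a b (2 * PI * xi) (PI / 2)).
    split; [|apply locally_singleton; trivial].
    apply (@is_RInt_ext C_R_NormedModule
      (fun x => (f x * cos (2 * PI * xi * x + 0), f x * cos (2 * PI * xi * x + PI / 2)))).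
    + intros x _.
      replace (- (2 * PI * Ci * RtoC x * RtoC xi))%C with ((0, - (2 * PI * xi * x)) : C).
      * rewrite Cexp_i, cos_neg, sin_neg, Rplus_0_r, cos_plus, cos_PI2, sin_PI2.
        apply injective_projections; simpl; ring.
      * apply injective_projections; simpl; ring.
    + apply (is_RInt_fct_extend_pair
        (fun x => (f x * cos (2 * PI * xi * x + 0), f x * cos (2 * PI * xi * x + PI / 2)))).
      * apply (is_RInt_extend _ A a b); trivial.
        -- intros x Hx. simpl. rewrite HA by trivial. ring.
        -- apply is_RInt_cosint; trivial.
      * apply (is_RInt_extend _ A a b); trivial.
        -- intros x Hx. simpl. rewrite HA by trivial. ring.
        -- apply is_RInt_cosint; trivial.
Qed.

(** The product of the transform at [k/u] with the exponential is a rotation by the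
    angle [w k * t], which [cosint_phase] rewrites as a shift of the phase. *)
Lemma poisson_summation : forall (f f1 f2 : R -> R) A,
  (forall x, is_derive f x (f1 x)) -> (forall x, is_derive f1 x (f2 x)) ->
  (forall x, continuous f2 x) -> (forall x, A < Rabs x -> f x = 0) ->
  forall u t : R, 0 < u ->
  exists s : R,
    is_sum_Z (V := R_NormedModule) (fun k : Z => f (t + u * IZR k)) s /\
    is_sum_Z (V := C_R_NormedModule)
      (fun k : Z =>
         (RtoC (1 / u) * Fourier f (RtoC (IZR k / u))
          * Cexp (2 * PI * Ci * RtoC (IZR k) * RtoC t / RtoC u))%C)
      (RtoC s).
Proof.
  intros f f1 f2 A D1 D2 C2 HA u t Hu.
  assert (C0 : forall x, continuous f x)
    by (intros x; apply @ex_derive_continuous; eexists; apply D1).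
  destruct (INR_archimed u (A + Rabs t) Hu) as [K HK].
  pose proof (Rle_abs t) as Ht1. pose proof (Rle_abs (- t)) as Ht2. rewrite Rabs_Ropp in Ht2.
  exists (rsum (fun j => f (t + u * IZR j)) (Zinterval K)). split.
  - apply is_sum_Z_finite_support. intros k Hk. apply HA.
    assert (H : INR K + 1 <= Rabs (IZR k)).
    { rewrite Rabs_Zabs, INR_IZR_INZ, <- plus_IZR. apply IZR_le. lia. }
    pose proof (Rabs_triang (t + u * IZR k) (- t)) as H1.
    replace (t + u * IZR k + - t) with (u * IZR k) in H1 by ring.
    rewrite Rabs_Ropp, Rabs_mult, (Rabs_right u) in H1 by lra. nra.
  - destruct (poisson_components f f1 f2 A u t K D1 D2 C2 HA Hu) as [Hre Him]; [lra|].
    set (a := t - u / 2 - u * INR K) in *. set (b := t + u / 2 + u * INR K) in *.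
    set (w := fun k => 2 * PI / u * IZR k) in *.
    assert (E : forall k,
      (RtoC (1 / u) * Fourier f (RtoC (IZR k / u))
          * Cexp (2 * PI * Ci * RtoC (IZR k) * RtoC t / RtoC u))%C
      = (/ u * cosint f a b (w k) (- (w k * t)), / u * cosint f a b (w k) (PI / 2 - w k * t))).
    { intros k. rewrite (Fourier_cosint f A a b) by (trivial; unfold a, b; lra).
      replace (2 * PI * Ci * RtoC (IZR k) * RtoC t / RtoC u)%C with ((0, w k * t) : C).
      2:{ unfold w. apply injective_projections; simpl; field; lra. }
      replace (2 * PI * (IZR k / u)) with (w k) by (unfold w; field; lra).
      rewrite Cexp_i, (cosint_phase f a b (w k) (- (w k * t)) C0),
        (cosint_phase f a b (w k) (PI / 2 - w k * t) C0).
      rewrite cos_neg, sin_neg, cos_shift, sin_shift.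
      apply injective_projections; simpl; field; lra. }
    apply is_sum_Z_C.
    + eapply is_sum_Z_ext; [|exact Hre]. intros k. rewrite E. reflexivity.
    + eapply is_sum_Z_ext; [|exact Him]. intros k. rewrite E. reflexivity.
Qed.

Theorem theorem5 :
  forall phi : R -> R, is_up_function phi ->
  forall u t : R, 0 < u ->
  exists s : R,
    is_sum_Z (V := R_NormedModule) (fun k : Z => phi (t + u * IZR k)) s /\
    is_sum_Z (V := C_R_NormedModule)
      (fun k : Z =>
         (RtoC (1 / u) * Fourier phi (RtoC (IZR k / u))
          * Cexp (2 * PI * Ci * RtoC (IZR k) * RtoC t / RtoC u))%C)
      (RtoC s).
Proof.
  intros phi Hphi.
  apply (poisson_summation phi (Derive_n phi 1) (Derive_n phi 2) 1).
  - intros x. apply Derive_correct. apply (up_smooth phi Hphi 1 x).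
  - intros x. apply Derive_correct. apply (up_smooth phi Hphi 2 x).
  - intros x. apply @ex_derive_continuous. apply (up_smooth phi Hphi 3 x).
  - intros x Hx. destruct (Req_dec (phi x) 0) as [H|H]; trivial. exfalso.
    assert (Hs : support phi x).
    { intros V [d Hd]. exists x. split; trivial. apply Hd. unfold disc.
      rewrite Rminus_diag, Rabs_R0. apply cond_pos. }
    apply (up_support phi Hphi) in Hs.
    apply Rabs_le in Hs. lra.
Qed.
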